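(* Let $r$ be a power of $2$. For each odd integer $n>0$ let $A_n\in t\,\mathbb{Z}/2[t^2]$, and suppose that for all odd $n>0$ \[ A_{n+16r}=t^{16r}A_n+t^{4r}A_{n+4r}+t^{2r}A_{n+2r}. \] Say that $A_n$ satisfies condition $(1\alpha)$ if, writing $t^n=[a,b]$: when $a>0$, $A_n=[a-1,b]+$ a sum of monomials preceding $[a-1,b]$; when $a=0$, $A_n$ is a sum of monomials each equal to or preceding $[0,b-1]$. If $A_n$ satisfies $(1\alpha)$ for every odd $n<16r^2$, then $A_n$ satisfies $(1\alpha)$ for every odd $n>0$.
   Context: $\mathbb{N}=\{0,1,2,\dots\}$. Let $g:\mathbb{N}\to\mathbb{N}$ be defined by $g(0)=0$, $g(2n)=4g(n)$, $g(2n+1)=g(2n)+1$. For $a,b\in\mathbb{N}$, $[a,b]$ denotes the monomial $t^{1+2g(a)+4g(b)}\in\mathbb{Z}/2[t]$; $(a,b)\mapsto[a,b]$ is a bijection from $\mathbb{N}\times\mathbb{N}$ onto the monomials $t^k$, $k$ odd and positive. Say $[c,d]$ precedes (is earlier than) $[a,b]$ if $c+d<a+b$, or $c+d=a+b$ and $d<b$. ''A sum of monomials'' with some property means a finite sum (possibly empty, i.e. $0$) of distinct monomials with that property. When $b=0$, no monomial is ''equal to or preceding $[0,b-1]$'', so the condition then means $A_n=0$. *)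

(* Defs.v *)
From mathcomp Require Import all_boot all_order all_algebra.
From mathcomp Require Import zify.

Set Implicit Arguments.
Unset Strict Implicit.
Unset Printing Implicit Defensive.

Import GRing.Theory.

Local Open Scope ring_scope.

(* The first argument bounds the number of halvings; any bound k >= n gives
   the same value. *)
Fixpoint g_rec (k n : nat) : nat :=
  if k is k'.+1 then (4 * g_rec k' n./2 + odd n)%N else 0%N.

Definition g (n : nat) : nat := g_rec n n.

Lemma g_rec_bound k n : (n <= k)%N -> g_rec k n = g n.
Proof.
elim/ltn_ind: n k => n IH k; rewrite /g; case: n IH => [|n] IH.
  by clear IH; elim: k => [|k IHk] //= _; rewrite IHk.
case: k => [//|k] lenk; rewrite [LHS]/= [RHS]/=.
by rewrite !IH //; lia.
Qed.

Lemma g_half n : g n = (4 * g n./2 + odd n)%N.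
Proof.
case: n => [|n] //; rewrite {1}/g [LHS]/= g_rec_bound //; lia.
Qed.

Lemma g0 : g 0 = 0%N. Proof. by []. Qed.

Lemma g_even n : g (2 * n) = (4 * g n)%N.
Proof. by rewrite g_half mul2n doubleK odd_double addn0. Qed.

Lemma g_odd n : g (2 * n + 1) = (g (2 * n) + 1)%N.
Proof.
rewrite g_half g_even addn1 mul2n /= odd_double.
by congr (4 * g _ + 1)%N; lia.
Qed.

Definition expo (a b : nat) : nat := (1 + 2 * g a + 4 * g b)%N.

Definition mono (a b : nat) : {poly 'F_2} := 'X^(expo a b).

Lemma expo_odd a b : odd (expo a b).
Proof. rewrite /expo; lia. Qed.

Lemma expo_inj a b c d : expo a b = expo c d -> a = c /\ b = d.
Proof.
rewrite /expo.
have [k] := ubnP (a + b); elim: k a b c d => // k IH a b c d lek E.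
have [ab0|ab0] := posnP (a + b).
  have gpos n : g n = 0%N -> n = 0%N.
    elim/ltn_ind: n => n IHn gn; have [//|n0] := posnP n.
    have H := g_half n; have := IHn n./2 ltac:(lia) ltac:(lia); lia.
  have [a0 b0] : a = 0%N /\ b = 0%N by lia.
  subst a b; rewrite !g0 in E.
  by rewrite (gpos c ltac:(lia)) (gpos d ltac:(lia)).
move: (g_half a) (g_half b) (g_half c) (g_half d) => ? ? ? ?.
have [] := IH a./2 b./2 c./2 d./2 ltac:(lia) ltac:(lia); lia.
Qed.

Lemma expo_surj n : odd n -> exists a b, n = expo a b.
Proof.
elim/ltn_ind: n => n IH on.
have [n1|n1] := leqP n 1; first by exists 0%N, 0%N; rewrite /expo !g0; lia.
pose m := (n./2)%N; pose n' := (2 * m./2./2 + 1)%N.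
have [a [b E]] := IH n' ltac:(rewrite /n' /m; lia) ltac:(rewrite /n'; lia).
exists (2 * a + odd m)%N, (2 * b + odd m./2)%N.
have gD c (e : bool) : g (2 * c + e) = (4 * g c + e)%N.
  by case: e; rewrite ?g_odd ?addn0 g_even.
move: E; rewrite /expo !gD /n' /m; lia.
Qed.

Lemma mono_inj a b c d : mono a b = mono c d -> a = c /\ b = d.
Proof.
move=> /(congr1 (fun p : {poly 'F_2} => size p)).
by rewrite !size_polyXn => /succn_inj/expo_inj.
Qed.

Definition precedes (p q : nat * nat) : bool :=
  (p.1 + p.2 < q.1 + q.2)%N || ((p.1 + p.2 == q.1 + q.2)%N && (p.2 < q.2)%N).

Definition sum_of_monos (P : pred (nat * nat)) (f : {poly 'F_2}) : Prop :=
  exists s : seq (nat * nat),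
    [/\ uniq [seq mono p.1 p.2 | p <- s], all P s
      & f = \sum_(p <- s) mono p.1 p.2].

(* t Z/2[t^2] *)
Definition in_tZ2t2 (f : {poly 'F_2}) : Prop :=
  exists q : {poly 'F_2}, f = 'X * (q \Po 'X^2).

(* For odd n, the pair (a, b) with t^n = [a, b] exists (expo_surj) and is
   unique (mono_inj), so the quantification over it is never vacuous. *)
Definition cond1alpha (n : nat) (f : {poly 'F_2}) : Prop :=
  forall a b : nat, 'X^n = mono a b ->
    match a, b with
    | a'.+1, _ =>
        exists2 h, sum_of_monos (fun p => precedes p (a', b)) h
                 & f = mono a' b + h
    | 0, b'.+1 =>
        sum_of_monos (fun p => (p == (0, b')%N) || precedes p (0, b')%N) f
    | 0, 0 => f = 0
    end.

(* Main.v *)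
Require Import Defs.
From mathcomp Require Import all_boot all_order all_algebra.
From mathcomp Require Import zify ring.
Import GRing.Theory.
Local Open Scope ring_scope.

(** Squaring the characteristic polynomial of the recursion shows that it also
    holds with [r] replaced by [2 ^ j * r].  If [n >= 16 r^2], choose [m] with
    [16 * 4 ^ m <= n < 64 * 4 ^ m]; then [4 ^ m] and [2 * 4 ^ m] are admissible
    replacements of [r], and the first one (if [n < 32 * 4 ^ m]) or the second
    one (otherwise) expresses [A n] through earlier [A k].  The powers of [t]
    in that expression have the form [2 * 4 ^ i] or [4 * 4 ^ i], and multiplying
    [[c, d]] by such a power adds a binary digit [2 ^ i] to [c] or [d]: the
    weight [c + d] grows by at most [2 ^ i], with equality only when the carries
    are controlled.  Hence exactly one summand contributes the leading monomial
    and the remaining terms precede it. *)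

(** * Carries and the weight [c + d] *)

Lemma g_add_pow2 m c : ~~ odd (c %/ 2 ^ m) -> g (c + 2 ^ m) = (g c + 4 ^ m)%N.
Proof.
elim: m c => [|m IH] c.
  rewrite !expn0 divn1 => ec; move: (g_half c) (g_half (c + 1)) => -> ->.
  have -> : ((c + 1)./2 = c./2)%N by lia.
  lia.
rewrite !expnS divnMA divn2 => /IH E.
move: (g_half c) (g_half (c + 2 * 2 ^ m)) => -> ->.
have -> : ((c + 2 * 2 ^ m)./2 = c./2 + 2 ^ m)%N by lia.
rewrite E; lia.
Qed.

Lemma leq_g c : (c <= g c)%N.
Proof.
elim/ltn_ind: c => c IH; have [-> //|c0] := posnP c.
have := IH c./2 ltac:(lia); rewrite (g_half c); lia.
Qed.

Lemma g_lt_pow m c : (g c < 4 ^ m)%N -> (c < 2 ^ m)%N.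
Proof.
elim: m c => [|m IH] c; first by have := leq_g c; rewrite !expn0; lia.
rewrite (g_half c) !expnS => H; have := IH c./2 ltac:(lia); lia.
Qed.

Lemma expo_halves c d :
  expo c d = (4 * expo c./2 d./2 + 2 * odd c + 4 * odd d - 3)%N.
Proof. rewrite /expo (g_half c) (g_half d). lia. Qed.

Lemma expo_add2 c d c' d' : expo c' d' = (expo c d + 2)%N ->
  (c' + d' <= c + d + 1)%N /\
  (c' + d' = c + d + 1 -> [/\ c' = c + 1, d' = d & ~~ odd c])%N.
Proof.
have [k] := ubnP (c + d + c' + d').
elim: k c d c' d' => // k IH c d c' d' lek.
rewrite (expo_halves c) (expo_halves c') => E.
have [o1 o2] := (expo_odd c./2 d./2, expo_odd c'./2 d'./2).
(* Two odd digits are both cleared, and the carry adds 2 to the exponent of the halves. Otherwise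
   the halves do not change. *)
have [cd|cd] := boolP (odd c && odd d).
  have {}IH := IH c./2 d./2 c'./2 d'./2 ltac:(lia) ltac:(lia).
  lia.
have /expo_inj[? ?] : expo c'./2 d'./2 = expo c./2 d./2 by lia.
by split=> [|?]; [lia | split; lia].
Qed.

(* Adding the binary digit [2 ^ m] to the first coordinate: a carry never
   increases the weight [c + d]. *)
Lemma expo_addl m c d c' d' : expo c' d' = (expo c d + 2 * 4 ^ m)%N ->
  (c' + d' <= c + d + 2 ^ m)%N /\
  (c' + d' = c + d + 2 ^ m ->
     [/\ c' = c + 2 ^ m, d' = d & ~~ odd (c %/ 2 ^ m)])%N.
Proof.
elim: m c d c' d' => [|m IH] c d c' d'.
  by rewrite !expn0 divn1; apply: expo_add2.
rewrite (expo_halves c) (expo_halves c') !expnS divnMA divn2 => E.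
have [o1 o2] := (expo_odd c./2 d./2, expo_odd c'./2 d'./2).
have [I1 I2] := IH c./2 d./2 c'./2 d'./2 ltac:(lia).
split; first by lia.
move=> H; have [] := I2 ltac:(lia) => *; split => //; lia.
Qed.

(* A carry out of the second coordinate goes into the first one, at twice the
   value, so here one carry is weight neutral. *)
Lemma expo_addr m c d c' d' : expo c' d' = (expo c d + 4 * 4 ^ m)%N ->
  (c' + d' <= c + d + 2 ^ m)%N /\
  (c' + d' = c + d + 2 ^ m ->
     if odd (d %/ 2 ^ m) then d = d' + 2 ^ m else d' = d + 2 ^ m)%N.
Proof.
elim: m c d c' d' => [|m IH] c d c' d';
  rewrite (expo_halves c) (expo_halves c');
  have [o1 o2] := (expo_odd c./2 d./2, expo_odd c'./2 d'./2).
  rewrite !expn0 divn1 => E; case: ifP => od.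
    have [I1 I2] := @expo_add2 c./2 d./2 c'./2 d'./2 ltac:(lia).
    by split=> [|H]; [lia | have [] := I2 ltac:(lia); lia].
  have /expo_inj : expo c'./2 d'./2 = expo c./2 d./2 by lia.
  lia.
rewrite !expnS divnMA divn2 => E.
have [I1 I2] := IH c./2 d./2 c'./2 d'./2 ltac:(lia).
split; first by lia.
move=> H; have := I2 ltac:(lia); case: ifP => *; lia.
Qed.

Lemma odd_divn_pow2 m d : (d < 2 ^ m.+1)%N -> odd (d %/ 2 ^ m) = (2 ^ m <= d)%N.
Proof.
rewrite expnS => ltd; have p : (0 < 2 ^ m)%N by rewrite expn_gt0.
have [le|lt] := leqP (2 ^ m)%N d; last by rewrite divn_small.
have -> : (d = 1 * 2 ^ m + (d - 2 ^ m))%N by lia.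
by rewrite divnMDl // divn_small //; lia.
Qed.

(** * Supports and condition (1 alpha) *)

(** Coefficientwise form of [sum_of_monos]: sums and shifts need no bookkeeping of distinct list
    entries. *)
Definition supported (P : pred (nat * nat)) (f : {poly 'F_2}) : Prop :=
  forall e, f`_e != 0 -> exists2 p, e = expo p.1 p.2 & P p.

Lemma supportedW (P Q : pred (nat * nat)) f :
  (forall p, P p -> Q p) -> supported P f -> supported Q f.
Proof. by move=> PQ Pf e /Pf[p -> /PQ]; exists p. Qed.

Lemma supportedD P f h : supported P f -> supported P h -> supported P (f + h).
Proof.
move=> Pf Ph e; rewrite coefD; have [f0|/Pf //] := eqVneq f`_e 0.
by rewrite f0 add0r => /Ph.
Qed.

Lemma supported_mono (P : pred (nat * nat)) a b :
  P (a, b) -> supported P (mono a b).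
Proof.
move=> Pab e; rewrite coefXn; case: (e =P expo a b) => [->|_]; last by rewrite eqxx.
by exists (a, b).
Qed.

(** An even shift keeps exponents odd, so each still comes from a pair. *)
Lemma supported_shift (P Q : pred (nat * nat)) k f : ~~ odd k ->
  (forall p q, P p -> expo q.1 q.2 = (expo p.1 p.2 + k)%N -> Q q) ->
  supported P f -> supported Q ('X^k * f).
Proof.
move=> ek PQ Pf e; rewrite coefXnM; case: ltnP => [|ke]; first by rewrite eqxx.
case/Pf=> p Ep Pp.
have oe : odd e by have := expo_odd p.1 p.2; rewrite -Ep; lia.
have [a [b Eab]] := expo_surj oe.
by exists (a, b); rewrite //=; apply: (PQ p) => //=; rewrite -Eab -Ep subnK.
Qed.

Lemma F2_neq0 (x : 'F_2) : x != 0 -> x = 1.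
Proof. by case: x => [[|[|[]]] //] i _; apply: val_inj. Qed.

Lemma addpp2 (f : {poly 'F_2}) : f + f = 0.
Proof. by rewrite -mulr2n -mulr_natl -polyC_natr char_Zp // mul0r. Qed.

Lemma supportedP P f : sum_of_monos P f <-> supported P f.
Proof.
split=> [[s [_ Ps ->]]|Pf].
  elim: s Ps => [_ e|p s IH /= /andP[Pp /IH Ps]].
    by rewrite big_nil coef0 eqxx.
  rewrite big_cons; apply: supportedD => //.
  by apply: supported_mono; case: p Pp.
pose l := [seq e <- iota 0 (size f) | f`_e != 0].
have [s Es Ps] : exists2 s, [seq expo p.1 p.2 | p <- s] = l & all P s.
  have: all (fun e => f`_e != 0) l by apply: filter_all.
  elim: l => [_|e l IH /= /andP[/Pf[p -> Pp] /IH[s <- Ps]]]; first by exists [::].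
  by exists (p :: s); rewrite //= Pp.
exists s; split => //.
  have -> : [seq mono p.1 p.2 | p <- s] = [seq 'X^e | e <- l].
    by rewrite -Es -map_comp.
  rewrite map_inj_uniq ?filter_uniq ?iota_uniq // => i j.
  by move/(congr1 (fun p : {poly 'F_2} => size p)); rewrite !size_polyXn => -[].
have -> : \sum_(p <- s) mono p.1 p.2 = \sum_(e <- l) 'X^e.
  by rewrite -Es big_map.
rewrite -[LHS]coefK big_filter poly_def -(big_mkord xpredT (fun i => f`_i *: 'X^i)).
rewrite /index_iota subn0 [RHS]big_mkcond; apply: eq_bigr => e _ /=.
by case: eqP => [->|/eqP/F2_neq0->]; rewrite ?scale0r ?scale1r.
Qed.

(* [below a b] is "precedes [a - 1, b]" without truncated subtraction; for
   [a = 0] it is "equal to or precedes [0, b - 1]". *)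
Definition below (a b : nat) : pred (nat * nat) := fun p =>
  (p.1 + p.2 + 1 < a + b)%N || ((p.1 + p.2 + 1 == a + b)%N && (p.2 < b)%N).

(** Also admits the leading pair [(a - 1, b)], for summands that must stay below the lead
    entirely. *)
Definition below_eq (a b : nat) : pred (nat * nat) := fun p =>
  (p.1 + p.2 + 1 < a + b)%N || ((p.1 + p.2 + 1 == a + b)%N && (p.2 <= b)%N).

Definition lead (a b : nat) : {poly 'F_2} := if a is a'.+1 then mono a' b else 0.

(** With the lead set to 0 for [a = 0], one support condition covers all three cases of
    [cond1alpha]. *)
Definition lowers (a b : nat) (f : {poly 'F_2}) : Prop :=
  supported (below a b) (f - lead a b).

Lemma cond1alphaP a b f : cond1alpha (expo a b) f <-> lowers a b f.
Proof.
apply: (@iff_trans _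
  match a, b with
  | a'.+1, _ => exists2 h, sum_of_monos (fun p => precedes p (a', b)) h
                         & f = mono a' b + h
  | 0, b'.+1 =>
    sum_of_monos (fun p => (p == (0, b')%N) || precedes p (0, b')%N) f
  | 0, 0 => f = 0
  end).
  by split=> [/(_ a b erefl)//|H a1 b1 /Defs.mono_inj[<- <-]].
rewrite /lowers; case: a => [|a] /=; first case: b => [|b]; rewrite ?subr0.
- split=> [-> e|f0]; first by rewrite coef0 eqxx.
  apply/polyP=> e; rewrite coef0; apply/eqP; apply: contraT => /f0[p _].
  by rewrite /below; lia.
- apply: iff_trans (supportedP _ _) _; split; apply: supportedW => -[c d];
    rewrite /below /precedes xpair_eqE /=; lia.
split=> [[h /supportedP Ph ->]|Pf].
  rewrite addrAC subrr add0r; apply: supportedW Ph => -[c d].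
  by rewrite /below /precedes /=; lia.
exists (f - mono a b); last by rewrite addrC subrK.
apply/supportedP; apply: supportedW Pf => -[c d].
by rewrite /below /precedes /=; lia.
Qed.

Lemma lowers_below_eq a b f : lowers a b f -> supported (below_eq a b) f.
Proof.
move=> Pf; rewrite -[f](subrK (lead a b)); apply: supportedD.
  by apply: supportedW Pf => p; rewrite /below /below_eq; lia.
case: a {Pf} => [|a] /=; first by move=> e; rewrite coef0 eqxx.
by apply: supported_mono; rewrite /below_eq /=; lia.
Qed.

Lemma lowersD a b f h :
  lowers a b f -> supported (below a b) h -> lowers a b (f + h).
Proof. by move=> Pf Ph; rewrite /lowers addrAC; apply: supportedD. Qed.

(** * Effect of the summands of the recursion *)

(** A lower term with [2 ^ m <= d] may carry, but then [b < d] forces its weight to be strictly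
    smaller. *)
Lemma lowers_shiftr m a b f : (b < 2 ^ m)%N ->
  lowers a b f -> lowers a (b + 2 ^ m) ('X^(4 * 4 ^ m) * f).
Proof.
move=> ltb Pf; rewrite /lowers.
have -> : lead a (b + 2 ^ m) = 'X^(4 * 4 ^ m) * lead a b.
  case: a {Pf} => [|a] /=; first by rewrite mulr0.
  rewrite /mono -exprD /expo g_add_pow2 ?divn_small //; congr ('X^_); lia.
rewrite -mulrBr; apply: supported_shift Pf; first by lia.
move=> [c d] [c' d'] /= + /expo_addr; rewrite /below /= => H [H1 H2].
have [dlt|dge] := ltnP d (2 ^ m)%N; last by lia.
by move: H2; rewrite divn_small //=; lia.
Qed.

(** The digit condition bears on [a.-1] because the lead is [[a - 1, b]]. Terms that gain full
    weight keep their second coordinate, hence their order. *)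
Lemma lowers_shiftl m a b f : (0 < a)%N -> ~~ odd (a.-1 %/ 2 ^ m) ->
  lowers a b f -> lowers (a + 2 ^ m) b ('X^(2 * 4 ^ m) * f).
Proof.
case: a => [//|a] _ ea Pf; rewrite /lowers.
have -> : lead (a.+1 + 2 ^ m) b = 'X^(2 * 4 ^ m) * lead a.+1 b.
  rewrite addSn /= /mono -exprD /expo g_add_pow2 //; congr ('X^_); lia.
rewrite -mulrBr; apply: supported_shift Pf; first by lia.
move=> [c d] [c' d'] /= + /expo_addl; rewrite /below /= => H [H1 H2].
have [E|E] := eqVneq (c' + d')%N (c + d + 2 ^ m)%N; last by lia.
have [] := H2 E; lia.
Qed.

Lemma below_shiftl0 m b f : lowers 0 b f ->
  supported (below (2 ^ m) b) ('X^(2 * 4 ^ m) * f).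
Proof.
rewrite /lowers subr0; apply: supported_shift; first by lia.
move=> [c d] [c' d'] /= + /expo_addl; rewrite /below /= => H [H1 H2].
have [E|E] := eqVneq (c' + d')%N (c + d + 2 ^ m)%N; last by lia.
have [] := H2 E; lia.
Qed.

(** The shift of the index and the factor each add at most [2 ^ m] to the weight. For terms of top
    weight, [b1], [d] and [d'] all stay below [2 ^ m.+1], hence [d' < b + 2 ^ m.+1]. *)
Lemma below_addr m a b a1 b1 f : (b < 2 ^ m.+1)%N ->
  expo a1 b1 = (expo a b + 4 * 4 ^ m)%N -> lowers a1 b1 f ->
  supported (below a (b + 2 ^ m.+1)) ('X^(4 * 4 ^ m) * f).
Proof.
move=> ltb /expo_addr[I1 I2] /lowers_below_eq; apply: supported_shift; first by lia.
move=> [c d] [c' d'] /= + /expo_addr; rewrite /below /below_eq /= => H [H1 H2].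
have [E|E] := boolP ((a1 + b1 == a + b + 2 ^ m) && (c' + d' == c + d + 2 ^ m))%N;
  last by rewrite expnS; lia.
move: E => /andP[/eqP E1 /eqP E2].
move: (I2 E1) (H2 E2); rewrite (odd_divn_pow2 _ _ ltb) => {}I2 {}H2.
have b1lt : (b1 < 2 ^ m.+1)%N.
  by move: I2; rewrite expnS in ltb *; case: (leqP (2 ^ m) b); lia.
have dlt : (c + d + 1 == a1 + b1)%N -> (d < 2 ^ m.+1)%N by lia.
rewrite expnS in ltb b1lt dlt *.
have [D|D] := boolP (c + d + 1 == a1 + b1)%N; last by lia.
move: H2; rewrite odd_divn_pow2 ?expnS; [case: (leqP (2 ^ m) d); lia | lia].
Qed.

Lemma below_addl m a b a1 b1 f :
  expo a1 b1 = (expo a b + 2 * 4 ^ m)%N -> lowers a1 b1 f ->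
  supported (below a (b + 2 ^ m.+1)) ('X^(2 * 4 ^ m) * f).
Proof.
move=> /expo_addl[I1 I2] /lowers_below_eq; apply: supported_shift; first by lia.
have p : (0 < 2 ^ m)%N by rewrite expn_gt0.
move=> [c d] [c' d'] /= + /expo_addl; rewrite /below /below_eq expnS /= => H [H1 H2].
have [E|E] := boolP ((a1 + b1 == a + b + 2 ^ m) && (c' + d' == c + d + 2 ^ m))%N;
  last by lia.
move: E => /andP[/eqP/I2[? ? _] /eqP/H2[? ? _]]; lia.
Qed.

(** A term reaching the lead would have [c = a + 2 ^ m - 1]. Absence of carries gives [a < 2 ^ m],
    so with [0 < a] the digit [2 ^ m] of [c] is set, and adding it again would carry. *)
Lemma below_addll m a b a1 b1 f : (0 < a < 2 ^ m.+1)%N ->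
  expo a1 b1 = (expo a b + 2 * 4 ^ m)%N -> lowers a1 b1 f ->
  supported (below (a + 2 ^ m.+1) b) ('X^(2 * 4 ^ m) * f).
Proof.
move=> /andP[a0 alt] /expo_addl[I1 I2] /lowers_below_eq.
apply: supported_shift; first by lia.
move=> [c d] [c' d'] /= + /expo_addl; rewrite /below /below_eq /= => H [H1 H2].
have [E|E] := boolP ((a1 + b1 == a + b + 2 ^ m) && (c' + d' == c + d + 2 ^ m))%N;
  last by rewrite expnS; lia.
move: E => /andP[/eqP/I2[? ? Ia] /eqP/H2[? ? Ic]].
rewrite odd_divn_pow2 // in Ia.
have [D|D] := boolP ((c + d + 1 == a1 + b1) && (d == b))%N;
  last by rewrite expnS; lia.
move: Ic; rewrite odd_divn_pow2 expnS; lia.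
Qed.

(** Weight alone decides: the total gain is at most [2 * 2 ^ m], less than [2 ^ m.+2]. *)
Lemma below_addrl m a b a1 b1 f :
  expo a1 b1 = (expo a b + 4 * 4 ^ m)%N -> lowers a1 b1 f ->
  supported (below (a + 2 ^ m.+2) b) ('X^(4 * 4 ^ m) * f).
Proof.
move=> /expo_addr[I1 _] /lowers_below_eq; apply: supported_shift; first by lia.
have p : (0 < 2 ^ m)%N by rewrite expn_gt0.
move=> [c d] [c' d'] /= + /expo_addr[H1 _].
by rewrite /below /below_eq !expnS /=; lia.
Qed.

(** * Doubling the recursion *)

Definition recursion (A : nat -> {poly 'F_2}) (s : nat) : Prop := forall n, odd n ->
  A (n + 16 * s)%N = 'X^(16 * s) * A n + 'X^(4 * s) * A (n + 4 * s)%N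
                     + 'X^(2 * s) * A (n + 2 * s)%N.

(* The characteristic polynomial at [s] is the [2 s]-th power of
   [X^8 + t^8 + t^2 X^2 + t X]; this is squaring it. *)
Lemma recursion_double A s : recursion A s -> recursion A (2 * s).
Proof.
move=> rec n on.
have -> : (n + 16 * (2 * s) = n + 16 * s + 16 * s)%N by lia.
rewrite rec; last by lia.
have -> : (n + 16 * s + 4 * s = n + 4 * s + 16 * s)%N by lia.
have -> : (n + 16 * s + 2 * s = n + 2 * s + 16 * s)%N by lia.
rewrite !rec; try lia.
have -> : (n + 4 * s + 4 * s = n + 4 * (2 * s))%N by lia.
have -> : (n + 2 * s + 4 * s = n + 4 * s + 2 * s)%N by lia.
have -> : (n + 2 * s + 2 * s = n + 2 * (2 * s))%N by lia.
have -> : (n + 2 * (2 * s) = n + 4 * s)%N by lia.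
have -> : 'X^(16 * (2 * s)) = 'X^(16 * s) * 'X^(16 * s) :> {poly 'F_2}.
  by rewrite -exprD; congr ('X^_); lia.
have -> : 'X^(4 * (2 * s)) = 'X^(4 * s) * 'X^(4 * s) :> {poly 'F_2}.
  by rewrite -exprD; congr ('X^_); lia.
have -> : 'X^(2 * (2 * s)) = 'X^(2 * s) * 'X^(2 * s) :> {poly 'F_2}.
  by rewrite -exprD; congr ('X^_); lia.
set u := 'X^(16 * s); set v := 'X^(4 * s); set w := 'X^(2 * s).
set x := A n; set y := A (n + 4 * s)%N; set y2 := A (n + 2 * s)%N.
set z := A (n + 4 * (2 * s))%N; set z2 := A (n + 4 * s + 2 * s)%N.
(* The cross terms; each occurs twice and cancels in characteristic 2. *)
set c := u * v * y + u * w * y2 + v * w * z2.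
transitivity (u * u * x + v * v * z + w * w * y + (c + c)); first by rewrite /c; ring.
by rewrite addpp2 addr0.
Qed.

Lemma recursion_pow2 A s j : recursion A s -> recursion A (2 ^ j * s).
Proof.
move=> rec; elim: j => [|j IH]; first by rewrite mul1n.
by rewrite expnS -mulnA; apply: recursion_double.
Qed.

(** * Inductive step in the two ranges of [n] *)

Lemma lowers_step_low A m n a b : recursion A (4 ^ m) -> odd n ->
  (16 * 4 ^ m <= n < 32 * 4 ^ m)%N ->
  (forall k c d, (k < n)%N -> k = expo c d -> lowers c d (A k)) ->
  n = expo a b -> lowers a b (A n).
Proof.
move=> rec on /andP[len ltn] IH.
have p : (0 < 4 ^ m)%N by rewrite expn_gt0.
set n0 := (n - 16 * 4 ^ m)%N; have on0 : odd n0 by rewrite /n0; lia.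
have En : n = (n0 + 16 * 4 ^ m)%N by rewrite /n0; lia.
have [a0 [b0 E0]] := expo_surj on0.
(* Since [n0 < 16 * 4 ^ m], the digit [2 ^ m.+1] of [b0] is free, and adding
   [16 * 4 ^ m = 4 * 4 ^ m.+1] sets it. *)
have b0lt : (b0 < 2 ^ m.+1)%N.
  by apply: g_lt_pow; move: E0; rewrite /expo expnS; lia.
have Eab : n = expo a0 (b0 + 2 ^ m.+1).
  move: E0; rewrite /expo g_add_pow2 ?divn_small // expnS; lia.
rewrite {1}Eab => /expo_inj[<- <-].
have [a1 [b1 E1]] := @expo_surj (n0 + 4 * 4 ^ m) ltac:(lia).
have [a2 [b2 E2]] := @expo_surj (n0 + 2 * 4 ^ m) ltac:(lia).
rewrite En rec // -addrA; apply: lowersD.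
  have -> : (16 * 4 ^ m = 4 * 4 ^ m.+1)%N by rewrite expnS; lia.
  by apply: lowers_shiftr => //; apply: IH => //; lia.
apply: supportedD.
  by apply: (below_addr _ _ _ a1 b1) => //; [lia | apply: IH => //; lia].
by apply: (below_addl _ _ _ a2 b2) => //; [lia | apply: IH => //; lia].
Qed.

(* Using the recursion at [4 ^ m] here could bring terms of top weight with too
   large a second coordinate, hence the doubled step. *)
Lemma lowers_step_high A m n a b : recursion A (2 * 4 ^ m) -> odd n ->
  (32 * 4 ^ m <= n < 64 * 4 ^ m)%N ->
  (forall k c d, (k < n)%N -> k = expo c d -> lowers c d (A k)) ->
  n = expo a b -> lowers a b (A n).
Proof.
move=> rec on /andP[len ltn] IH.
have p : (0 < 4 ^ m)%N by rewrite expn_gt0.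
set n0 := (n - 32 * 4 ^ m)%N; have on0 : odd n0 by rewrite /n0; lia.
have En : n = (n0 + 16 * (2 * 4 ^ m))%N by rewrite /n0; lia.
have [a0 [b0 E0]] := expo_surj on0.
have a0lt : (a0 < 2 ^ m.+2)%N.
  by apply: g_lt_pow; move: E0; rewrite /expo !expnS; lia.
have Eab : n = expo (a0 + 2 ^ m.+2) b0.
  move: E0; rewrite /expo g_add_pow2 ?divn_small // !expnS; lia.
rewrite {1}Eab => /expo_inj[<- <-].
have [a1 [b1 E1]] := @expo_surj (n0 + 2 * 4 ^ m.+1) ltac:(lia).
have [a2 [b2 E2]] := @expo_surj (n0 + 4 * 4 ^ m) ltac:(lia).
have I0 : lowers a0 b0 (A n0) by apply: IH => //; lia.
have I1 : lowers a1 b1 (A (n0 + 2 * 4 ^ m.+1)%N).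
  by apply: IH => //; rewrite expnS; lia.
have I2 : lowers a2 b2 (A (n0 + 4 * 4 ^ m)%N) by apply: IH => //; lia.
rewrite En rec //.
have -> : (16 * (2 * 4 ^ m) = 2 * 4 ^ m.+2)%N by rewrite !expnS; lia.
have -> : (4 * (2 * 4 ^ m) = 2 * 4 ^ m.+1)%N by rewrite !expnS; lia.
have -> : (2 * (2 * 4 ^ m) = 4 * 4 ^ m)%N by lia.
apply: lowersD; last by apply: (below_addrl _ _ _ a2 b2) => //; lia.
(* For [a0 > 0] the lead comes from [A n0]. For [a0 = 0] that polynomial has no lead, and the
   summand with index [expo (2 ^ m.+1) b0] supplies it: the digit [2 ^ m.+1] of [2 ^ m.+1 - 1] is
   free. *)
have [a00|a0gt] := posnP a0; last first.
  apply: lowersD; first by apply: lowers_shiftl => //; rewrite divn_small //; lia.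
  by apply: (below_addll _ _ _ a1 b1); rewrite ?a0gt //; lia.
subst a0; rewrite addrC; apply: lowersD; last exact: below_shiftl0.
have /expo_inj[Ea Eb] : expo a1 b1 = expo (0 + 2 ^ m.+1) b0.
  by move: E0 E1; rewrite /expo g_add_pow2 ?div0n //; lia.
rewrite Ea Eb !add0n in I1.
have q : (0 < 2 ^ m.+1)%N by rewrite expn_gt0.
have -> : (0 + 2 ^ m.+2 = 2 ^ m.+1 + 2 ^ m.+1)%N by rewrite !expnS; lia.
by apply: lowers_shiftl; rewrite // divn_small //; lia.
Qed.

Theorem theorem4p1 (r : nat) (A : nat -> {poly 'F_2})
    (hr : exists k : nat, r = (2 ^ k)%N)
    (hA : forall n : nat, odd n -> in_tZ2t2 (A n))
    (hrec : forall n : nat, odd n ->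
       A (n + 16 * r)%N =
         'X^(16 * r) * A n + 'X^(4 * r) * A (n + 4 * r)%N
           + 'X^(2 * r) * A (n + 2 * r)%N)
    (hinit : forall n : nat, odd n -> (n < 16 * r ^ 2)%N -> cond1alpha n (A n)) :
  forall n : nat, odd n -> cond1alpha n (A n).
Proof.
suff main n a b : n = expo a b -> lowers a b (A n).
  by move=> n /expo_surj[a [b ->]]; apply/cond1alphaP/main.
elim/ltn_ind: n a b => n IH a b En.
have on : odd n by rewrite En expo_odd.
have [small|large] := ltnP n (16 * r ^ 2)%N.
  by move: (hinit n on small); rewrite {1}En => /cond1alphaP.
have {}IH k c d : (k < n)%N -> k = expo c d -> lowers c d (A k) by move/IH; apply.
case: hr => k Er.
have r2 : (r ^ 2 = 4 ^ k)%N by rewrite Er -expnM mulnC expnM.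
have rpos : (0 < r ^ 2)%N by rewrite r2 expn_gt0.
pose m := trunc_log 4 (n %/ 16).
have /andP[lo hi] : (4 ^ m <= n %/ 16 < 4 ^ m.+1)%N by apply: trunc_log_bounds; lia.
have km : (k <= m)%N by apply: trunc_log_max => //; lia.
have rec : recursion A (4 ^ m).
  (* The subtraction is exact because [k <= m]. *)
  have -> : (4 ^ m = 2 ^ (2 * m - k) * r)%N.
    by rewrite Er -expnD subnK ?expnM //; lia.
  exact: recursion_pow2.
rewrite expnS in hi.
have [lt|ge] := ltnP n (32 * 4 ^ m)%N.
  by apply: (lowers_step_low A m) => //; lia.
by apply: (lowers_step_high A m) => //; [exact: recursion_double | lia].
Qed.
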